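(* Let $T$ be a tree on $n$ vertices with $M(T)\geq 4$. Then $T$ is $3$-NIM if and only if $T$ is the simple star $S_n$.
   Context: The simple star $S_n$ is the tree $K_{1,n-1}$ (one central vertex adjacent to $n-1$ leaves). For a tree $T$ with vertex set $\{1,\dots,n\}$, $\mathcal{S}(T)$ denotes the set of real symmetric $n\times n$ matrices $A=(a_{ij})$ such that for $i\neq j$, $a_{ij}\neq 0$ if and only if $\{i,j\}$ is an edge of $T$. For $A\in\mathcal{S}(T)$ and $\lambda\in\mathbb{R}$, $\mathrm{m}_A(\lambda)$ is the multiplicity of $\lambda$ as an eigenvalue of $A$, and $M(T)$ is the maximum of $\mathrm{m}_A(\lambda)$ over all $A\in\mathcal{S}(T)$, $\lambda\in\mathbb{R}$. $T$ is $3$-NIM if $M(T)\geq 3$ and, whenever $A\in\mathcal{S}(T)$ has an eigenvalue $\lambda$ with $\mathrm{m}_A(\lambda)=M(T)-2\geq 2$, every other eigenvalue of $A$ has multiplicity $1$. *)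

(* Defs.v *)
From HB Require Import structures.
From mathcomp Require Import all_boot all_order all_algebra.
From mathcomp Require Import reals.
Set Implicit Arguments. Unset Strict Implicit. Unset Printing Implicit Defensive.
Import Order.TTheory GRing.Theory Num.Theory.
Local Open Scope ring_scope.

Definition is_tree (n : nat) (e : rel 'I_n) : Prop :=
  [/\ (0 < n)%N, symmetric e, irreflexive e,
      (forall x y : 'I_n, connect e x y)
    & (forall c : seq 'I_n, ucycle e c -> (size c < 3)%N)].

Definition in_ST (R : realType) (n : nat) (e : rel 'I_n) (A : 'M[R]_n) : Prop :=
  A^T = A /\ (forall i j : 'I_n, i != j -> (A i j != 0) = e i j).

Definition mult (R : realType) (n : nat) (A : 'M[R]_n) (lam : R) : nat :=
  mup lam (char_poly A).

Definition is_M (R : realType) (n : nat) (e : rel 'I_n) (m : nat) : Prop :=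
  (exists A : 'M[R]_n, exists lam : R, in_ST e A /\ mult A lam = m) /\
  (forall (A : 'M[R]_n) (lam : R), in_ST e A -> (mult A lam <= m)%N).

(* T is 3-NIM, given that m = M(T). *)
Definition NIM3 (R : realType) (n : nat) (e : rel 'I_n) (m : nat) : Prop :=
  (3 <= m)%N /\
  forall (A : 'M[R]_n) (lam : R), in_ST e A ->
    mult A lam = (m - 2)%N -> (2 <= m - 2)%N ->
    forall mu : R, mu != lam -> (0 < mult A mu)%N -> mult A mu = 1%N.

Definition is_star (n : nat) (e : rel 'I_n) : Prop :=
  exists c : 'I_n, forall i j : 'I_n, e i j = (i != j) && ((i == c) || (j == c)).

(* Main.v *)
(** Star implies 3-NIM: an eigenvalue of multiplicity k >= 2 of a star matrix
    occurs at least k + 1 times on the diagonal at the leaves, and there are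
    not enough leaves for multiplicities m - 2 >= n - 4 and 2 together.

    Conversely, let T not be a star and let N be the kernel of A, of dimension
    m (shift the eigenvalue to 0).  Some vertex v has three branches B1, B2, B3
    with B1 of at least two vertices, and vertices u in B2, w in B3 whose
    coordinates are independent on N: take a branch B(b,v) minimal among those
    on which N has dimension at least 2, or any v if there is none.  The
    principal submatrix A[B1] is nonzero, so it has an eigenvalue nu <> 0.
    Rescaling the rows and columns of B1 by d preserves the pattern and the
    nullity and turns nu into mu = d^2 nu.  For generic d, nonzero changes of
    the diagonal entries at u and w make mu an eigenvalue of the submatrices on
    B2 and B3 too, so mu has multiplicity at least 3 - 1 = 2 in the whole
    matrix, while these two changes lower the nullity by exactly 2 whatever
    their size. *)

Require Import Defs.
From mathcomp Require Import all_boot all_order all_algebra.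
From mathcomp Require Import complex.
From mathcomp Require Import boolp reals.
From mathcomp Require Import zify ring.

Set Implicit Arguments. Unset Strict Implicit. Unset Printing Implicit Defensive.
Import Order.TTheory GRing.Theory Num.Theory.
Local Open Scope ring_scope.

(** * Symmetric matrices: multiplicities and nonzero eigenvalues *)

(** The height [m] of [P] is kept apart from [n] because [P] will be a stack of two row bases, whose
    number of rows equals [n] only propositionally. *)
Lemma char_poly_conj (F : fieldType) (m n : nat) (P : 'M[F]_(m, n)) A B :
  m = n -> row_free P -> P *m A = B *m P -> char_poly A = char_poly B.
Proof.
move=> eqmn; case: n / eqmn P A => P A; rewrite row_free_unit => Pu PA.
have dP : \det (map_mx polyC P) != 0.
  by rewrite det_map_mx polyC_eq0 -unitfE -unitmxE.
apply: (mulfI dP); rewrite /char_poly -det_mulmx mulrC -det_mulmx.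
congr (\det _); rewrite /char_poly_mx mulmxBr mulmxBl -!map_mxM PA.
by rewrite scalar_mxC.
Qed.

Lemma char_poly_scalar (F : fieldType) (n : nat) (a : F) :
  char_poly (a%:M : 'M_n) = ('X - a%:P) ^+ n.
Proof.
rewrite char_poly_trig ?scalar_mx_is_trig //.
rewrite (eq_bigr (fun=> 'X - a%:P)) => [|i _]; last by rewrite mxE eqxx mulr1n.
by rewrite prodr_const card_ord.
Qed.

Lemma rV_norm_eq0 (F : realFieldType) (n : nat) (x : 'rV[F]_n) :
  x *m x^T = 0 -> x = 0.
Proof.
move=> /matrixP /(_ 0 0); rewrite !mxE => /eqP.
rewrite psumr_eq0 => [|i _]; last by rewrite mxE -expr2 sqr_ge0.
move=> /allP x0; apply/rowP => i; have := x0 i (mem_index_enum i).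
by rewrite !mxE -expr2 expf_eq0 => /eqP.
Qed.

(* For a symmetric matrix the row space of A - lam is the orthogonal
   complement of its kernel, so both give an invariant decomposition. *)
Lemma mup_char_poly_sym (F : realFieldType) (n : nat) (A : 'M[F]_n) (lam : F) :
  A^T = A -> mup lam (char_poly A) = \rank (kermx (A - lam%:M)).
Proof.
move=> symA; set B := A - lam%:M; set K := kermx B.
have symB : B^T = B by rewrite /B linearB /= symA tr_scalar_mx.
have trivI : (K :&: B)%MS = 0.
  apply/eqP/rowV0P => x; rewrite sub_capmx => /andP[/sub_kermxP xB /submxP[y yx]].
  by apply: rV_norm_eq0; rewrite {2}yx trmx_mul symB mulmxA xB mul0mx.
have dimKB : (\rank K + \rank B = n)%N.
  by rewrite mxrank_ker subnK // rank_leq_row.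
set U := row_base K; set W := row_base B.
have UB : U *m B = 0 by apply/sub_kermxP; rewrite eq_row_base.
have UA : U *m A = lam%:M *m U.
  by move/eqP: UB; rewrite mulmxBr subr_eq0 => /eqP ->; rewrite scalar_mxC.
have /submxP[C WA] : (W *m A <= W)%MS.
  have -> : A = B + lam%:M by rewrite subrK.
  rewrite mulmxDr addmx_sub //; first by rewrite (submx_trans (submxMl _ _)) ?eq_row_base.
  by rewrite mul_mx_scalar scalemx_sub.
have Pfree : row_free (col_mx U W).
  rewrite /row_free -addsmxE mxrank_disjoint_sum; last first.
    by apply/eqP; rewrite -submx0 -trivI capmxS ?eq_row_base.
  by rewrite !eq_row_base.
rewrite (@char_poly_conj _ _ _ (col_mx U W) A (block_mx lam%:M 0 0 C)) //; last first.
  by rewrite mul_col_mx mul_block_col !mul0mx addr0 add0r UA WA.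
rewrite /char_poly char_block_diag_mx det_ublock -!/(char_poly _) char_poly_scalar.
rewrite mupMl ?mup_XsubCX ?eqxx // -eigenvalue_root_char.
(* An eigenvector of [C] for [lam] would give a nonzero vector in both the kernel and the row space
   of [B]. *)
apply/negP => /eigenvalueP[z zC z0].
have zWB : z *m W *m B = 0.
  by rewrite mulmxBr -mulmxA WA mulmxA zC mul_mx_scalar -scalemxAl subrr.
have : (z *m W <= (0 : 'M[F]_n))%MS.
  by rewrite -trivI sub_capmx; apply/andP; split;
    [apply/sub_kermxP | rewrite (submx_trans (submxMl _ _)) ?eq_row_base].
rewrite submx0 => /eqP zW0; case/negP: z0; apply/eqP.
by apply: (row_free_inj (row_base_free B)); rewrite zW0 mul0mx.
Qed.

(** By the spectral theorem over the complex extension: a hermitian matrix whose eigenvalues all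
    vanish is zero. The nonzero eigenvalue found is real, so it already has an eigenvector over
    [F]. *)
Lemma sym_nonzero_eigenvalue (F : rcfType) (n : nat) (A : 'M[F]_n) :
  A^T = A -> A != 0 ->
  exists nu : F, exists x : 'rV[F]_n, [/\ nu != 0, x != 0 & x *m A = nu *: x].
Proof.
move=> symA A0; set f := real_complex F; set B := map_mx f A.
have herm : B \is hermsymmx.
  apply: realsym_hermsym.
    by apply/is_hermitianmxP; rewrite expr0 scale1r map_mx_id // /B map_trmx symA.
  by apply/mxOverP => i j; rewrite mxE complex_real.
have /orthomx_spectralP BE := hermitian_normalmx herm.
have [k spk] : exists k, spectral_diag B 0 k != 0.
  apply/existsP; rewrite -negb_forall; apply: contra A0 => /forallP sp0.
  have {}sp0 : spectral_diag B = 0 by apply/rowP => k; rewrite mxE (eqP (sp0 k)).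
  have diag0 : diag_mx (spectral_diag B) = 0.
    by apply/matrixP => i j; rewrite sp0 !mxE mul0rn.
  by rewrite -(map_mx_eq0 f) -/B BE diag0 mulmx0 mul0mx.
have /mxOverP /(_ 0 k) /complex_realP[nu nuE] := hermitian_spectral_diag_real herm.
have : eigenvalue A nu.
  rewrite eigenvalue_root_char -(fmorph_root f) map_char_poly -eigenvalue_root_char.
  apply/eigenvalueP; exists (row k (spectralmx B)); last first.
    apply/eqP => rk0; have := spectral_unit B; rewrite -row_free_unit.
    by move=> /row_freeP[Q]; move/(congr1 (row k)); rewrite row_mul rk0 mul0mx =>
      /rowP/(_ k); rewrite !mxE eqxx => /esym/eqP; rewrite oner_eq0.
  rewrite -/B -row_mul {2}BE !mulmxA mulmxV ?spectral_unit // mul1mx.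
  by rewrite row_mul row_diag_mx -scalemxAl -rowE nuE.
move=> /eigenvalueP[x xA x0]; exists nu, x; split=> //.
by apply: contra spk => /eqP nu0; rewrite nuE nu0.
Qed.

(** * Principal submatrices, coordinate bounds and diagonal changes *)

(** Padding the principal submatrix with zeros avoids reindexing. It can only add the eigenvalue 0,
    hence the conditions [mu != 0] below. *)
Definition restr (F : fieldType) (n : nat) (B : {set 'I_n}) (A : 'M[F]_n) : 'M[F]_n :=
  \matrix_(i, j) (A i j *+ ((i \in B) && (j \in B))).

(** Reading off the coordinates in [S] is injective on the row space of [K]. *)
Lemma rank_le_coords (F : fieldType) (m n : nat) (K : 'M[F]_(m, n)) (S : {set 'I_n}) :
  (forall x : 'rV_n, (x <= K)%MS -> (forall i, i \in S -> x 0 i = 0) -> x = 0) ->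
  (\rank K <= #|S|)%N.
Proof.
move=> detS; pose Q : 'M[F]_(n, #|S|) := colsub enum_val 1%:M.
rewrite -(mxrank_mul_ker K Q); suff -> : (K :&: kermx Q)%MS = 0.
  by rewrite mxrank0 addn0 rank_leq_col.
apply/eqP/rowV0P => x; rewrite sub_capmx => /andP[xK /sub_kermxP xQ].
apply: detS => // i iS; move/rowP: xQ => /(_ (enum_rank_in iS i)).
by rewrite mulmx_colsub mulmx1 !mxE enum_rankK_in.
Qed.

(** If the changed matrix kills [z], pairing with [x] and using symmetry leaves [s * z_u = 0], and
    [y] gives [t * z_w = 0]. So the new kernel is the part of the old one where the coordinates [u]
    and [w] vanish, and [x], [y] show these two conditions to be independent. *)
Lemma nullity_two_bumps (F : fieldType) (n : nat) (B : 'M[F]_n) (u w : 'I_n)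
    (x y : 'rV[F]_n) (s t : F) :
  B^T = B -> x *m B = 0 -> y *m B = 0 ->
  x 0 u = 1 -> x 0 w = 0 -> y 0 u = 0 -> y 0 w = 1 -> s != 0 -> t != 0 ->
  \rank (kermx B) = (\rank (kermx (B + (s *: delta_mx u u + t *: delta_mx w w)))).+2.
Proof.
move=> symB xB yB xu xw yu yw s0 t0.
set E := (_ + t *: _)%R; set K := kermx B.
have zE (z : 'rV[F]_n) i : (z *m E) 0 i = s * z 0 u *+ (i == u) + t * z 0 w *+ (i == w).
  rewrite mulmxDr -!scalemxAr.
  have zd j : z *m delta_mx j j = z 0 j *: delta_mx 0 j.
    rewrite -(mul_delta_mx (0 : 'I_1)) mulmxA -colE.
    by apply/rowP => k; rewrite !mxE big_ord1 !mxE.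
  by rewrite !zd !mxE /= !mulr_natr !mulrnAr.
pose Q : 'M[F]_(n, 1 + 1) := row_mx (delta_mx u 0) (delta_mx w 0).
have zQ p (Z : 'M[F]_(p, n)) : Z *m Q = row_mx (col u Z) (col w Z).
  by rewrite mul_mx_row -!colE.
have kerE : (kermx (B + E) :=: K :&: kermx Q)%MS.
  apply/eqmxP/rV_eqP => z; rewrite sub_capmx.
  apply/sub_kermxP/andP => [zBE | [/sub_kermxP zB /sub_kermxP zQ0]].
    have zEB (z' : 'rV_n) : z' *m B = 0 -> (z *m E) *m z'^T = 0.
      move=> z'B; have : z *m (B + E) *m z'^T = 0 by rewrite zBE mul0mx.
      by rewrite mulmxDr mulmxDl -[z *m B *m _]mulmxA -symB -trmx_mul z'B trmx0
                 mulmx0 add0r.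
    have dotE (z' : 'rV_n) : ((z *m E) *m z'^T) 0 0 =
        s * z 0 u * z' 0 u + t * z 0 w * z' 0 w.
      rewrite mxE (eq_bigr (fun i => (if i == u then s * z 0 u * z' 0 i else 0) +
         (if i == w then t * z 0 w * z' 0 i else 0))) => [|i _]; last first.
        by rewrite zE !mxE mulrDl !mulrnAl -!mulrb.
      by rewrite big_split /= -!big_mkcond /= !big_pred1_eq.
    have zu : z 0 u = 0.
      have := dotE x; rewrite zEB // xu xw mxE mulr1 mulr0 addr0 => /esym/eqP.
      by rewrite mulf_eq0 (negPf s0) => /eqP.
    have zw : z 0 w = 0.
      have := dotE y; rewrite zEB // yu yw mxE mulr1 mulr0 add0r => /esym/eqP.
      by rewrite mulf_eq0 (negPf t0) => /eqP.
    have zE0 : z *m E = 0.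
      by apply/rowP => i; rewrite zE zu zw !mulr0 !mul0rn addr0 mxE.
    split; apply/sub_kermxP; first by move: zBE; rewrite mulmxDr zE0 addr0.
    rewrite zQ -[RHS]row_mx0; congr row_mx;
      by apply/colP => i; rewrite !mxE ord1 ?zu ?zw.
  move: zQ0; rewrite zQ -[RHS]row_mx0 => /eq_row_mx[/colP/(_ 0) zu /colP/(_ 0) zw].
  rewrite !mxE in zu zw; rewrite mulmxDr zB add0r.
  by apply/rowP => i; rewrite zE zu zw !mulr0 !mul0rn addr0 mxE.
rewrite kerE -(mxrank_mul_ker K Q) -[RHS]add2n; congr (_ + _)%N.
apply/eqP; rewrite eqn_leq rank_leq_col /=.
have <- : \rank (col_mx x y *m Q) = 2%N.
  have -> : col_mx x y *m Q = 1%:M.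
    rewrite mul_col_mx !zQ scalar_mx_block.
    by congr (col_mx (row_mx _ _) (row_mx _ _)); apply/matrixP => i j;
      rewrite !mxE !ord1.
  by rewrite mxrank1.
by apply/mxrankS/submxMr; rewrite col_mx_sub; apply/andP; split; apply/sub_kermxP.
Qed.

(** * Eigenvectors supported on branches *)

(** The columns picked by [g] form a diagonal matrix with nonzero diagonal. *)
Lemma row_free_dual (F : fieldType) (p n : nat) (Y : 'M[F]_(p, n)) (g : 'I_p -> 'I_n) :
  (forall k l, (Y k (g l) != 0) = (k == l)) -> row_free Y.
Proof.
move=> Yg; apply: inj_row_free => z zY; apply/rowP => l; rewrite mxE.
move/rowP: zY => /(_ (g l)); rewrite !mxE (bigD1 l) //= big1 => [|k kl]; last first.
  by move: (Yg k l); rewrite (negPf kl) => /negbFE/eqP ->; rewrite mulr0.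
by rewrite addr0 => /eqP; rewrite mulf_eq0 -[Y _ _ == 0]negbK Yg eqxx orbF => /eqP.
Qed.

Lemma restr_eigenvector_supp (F : fieldType) (n : nat) (B : {set 'I_n}) (A : 'M[F]_n) mu (x : 'rV_n) :
  mu != 0 -> x *m restr B A = mu *: x -> forall j, j \notin B -> x 0 j = 0.
Proof.
move=> mu0 /rowP xB j jB; move: (xB j); rewrite !mxE big1 => [|i _].
  by move/esym/eqP; rewrite mulf_eq0 (negPf mu0) => /eqP.
by rewrite mxE (negPf jB) andbF mulr0.
Qed.

(** A column inside [B] acts on [x] as in the restricted matrix, since [x] is supported in [B]; a
    column outside [B] other than [v] is zero in the rows of [B]. *)
Lemma restr_eigenvector (F : fieldType) (n : nat) (v : 'I_n) (B : {set 'I_n})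
    (A : 'M[F]_n) mu (x : 'rV_n) :
  (forall i j, i \in B -> j \notin B -> j != v -> A i j = 0) ->
  mu != 0 -> x *m restr B A = mu *: x ->
  forall j, j != v -> (x *m (A - mu%:M)) 0 j = 0.
Proof.
move=> clB mu0 xB j jv; have supp := restr_eigenvector_supp mu0 xB.
rewrite mulmxBr mul_mx_scalar !mxE; case: (boolP (j \in B)) => jB.
  move/rowP: xB => /(_ j); rewrite !mxE => <-; rewrite -sumrB big1 // => i _.
  rewrite mxE jB andbT; case: (boolP (i \in B)) => iB; first by rewrite subrr.
  by rewrite supp // !mul0r subrr.
rewrite [x 0 j]supp // mulr0 subr0 big1 // => i _.
by case: (boolP (i \in B)) => iB; [rewrite clB ?mulr0 | rewrite supp ?mul0r].
Qed.

(* The three eigenvectors of the branches span a space on which A - mu has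
   rank at most one, its image being supported at v. *)
Lemma three_branches (F : fieldType) (n : nat) (v : 'I_n) (B : 'I_3 -> {set 'I_n})
    (A : 'M[F]_n) mu :
  (forall k i j, i \in B k -> j \notin B k -> j != v -> A i j = 0) ->
  (forall k l, k != l -> [disjoint B k & B l]) -> mu != 0 ->
  (forall k, exists2 x : 'rV_n, x != 0 & x *m restr (B k) A = mu *: x) ->
  (2 <= \rank (kermx (A - mu%:M)))%N.
Proof.
move=> clB disjB mu0 exB.
have /fin_all_exists[y yP] : forall k, exists x : 'rV[F]_n,
    x != 0 /\ x *m restr (B k) A = mu *: x.
  by move=> k; have [x] := exB k; exists x.
have /fin_all_exists[g gP] : forall k, exists i, y k 0 i != 0.
  move=> k; apply/existsP; rewrite -negb_forall; apply: contra (yP k).1.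
  by move=> /forallP y0; apply/eqP/rowP => i; rewrite mxE (eqP (y0 i)).
have supp k := restr_eigenvector_supp mu0 (yP k).2.
have gB k : g k \in B k.
  by apply: contraR (gP k) => gkB; apply/eqP/supp.
pose Y := \matrix_k y k; have Yfree : row_free Y.
  apply: (@row_free_dual _ _ _ _ g) => k l; rewrite mxE.
  case: (eqVneq k l) => [->|kl]; first exact: gP.
  apply/negbTE; rewrite negbK; apply/eqP/supp.
  by rewrite (disjointFl (disjB _ _ kl)).
have rkYB : (\rank (Y *m (A - mu%:M)) <= #|[set v]|)%N.
  apply: rank_le_coords => x /submxP[D ->] xv; apply/rowP => j.
  case: (eqVneq j v) => [-> | jv]; first by rewrite xv ?mxE // inE.
  rewrite mxE [RHS]mxE big1 // => k _.
  have -> : (Y *m (A - mu%:M)) k j = (y k *m (A - mu%:M)) 0 j.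
    by rewrite -[y k](rowK y) -row_mul [RHS]mxE.
  by rewrite (restr_eigenvector (clB k) mu0 (yP k).2) ?mulr0.
have := mxrank_mul_ker Y (A - mu%:M); rewrite (eqP Yfree) => rkE.
have := mxrankS (capmxSr Y (kermx (A - mu%:M))).
by rewrite cards1 in rkYB; lia.
Qed.

(* A bump at the diagonal entry u creates the eigenvalue mu as soon as neither
   S nor S with u deleted has it: the row u of adj(mu - S) is the eigenvector. *)
Lemma diagonal_bump_eigenvalue (F : fieldType) (n : nat) (S : 'M[F]_n) (u : 'I_n) (mu : F) :
  (char_poly S * char_poly (row' u (col' u S))).[mu] != 0 ->
  exists t : F, exists x : 'rV[F]_n,
    [/\ t != 0, x != 0 & x *m (S + t *: delta_mx u u) = mu *: x].
Proof.
have chE k (C : 'M[F]_k) : (char_poly C).[mu] = \det (mu%:M - C).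
  rewrite /char_poly -horner_evalE -det_map_mx; congr (\det _).
  by apply/matrixP => i j; rewrite !mxE /= horner_evalE hornerD hornerN hornerC hornerMn hornerX.
rewrite hornerM mulf_eq0 negb_or !chE; set M := mu%:M - S => /andP[dM dM'].
pose x := row u (\adj M).
have xM : x *m M = \det M *: delta_mx 0 u.
  by rewrite -row_mul mul_adj_mx; apply/rowP => j; rewrite !mxE eqxx /= eq_sym mulr_natr.
have xu : x 0 u != 0.
  rewrite !mxE /cofactor mulf_neq0 ?signr_eq0 //.
  have -> : row' u (col' u M) = mu%:M - row' u (col' u S) => //.
  by apply/matrixP => i j; rewrite !mxE (inj_eq lift_inj).
(* As [x S = mu x - det M e_u], this bump contributes exactly the missing [det M e_u]. *)
exists (\det M / x 0 u), x; split.
- by rewrite mulf_neq0 ?invr_eq0.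
- by apply: contraNneq xu => ->; rewrite mxE.
have -> : S = mu%:M - M by rewrite opprB addrC subrK.
rewrite mulmxDr mulmxBr mul_mx_scalar xM -scalemxAr -(mul_delta_mx (0 : 'I_1) u u) mulmxA -colE.
have -> : col u x *m delta_mx 0 u = x 0 u *: delta_mx 0 u :> 'rV_n.
  by apply/rowP => k; rewrite !mxE big_ord1 !mxE.
by rewrite scalerA divfK // subrK.
Qed.

(** As a polynomial in [d], the value of [r] is nonzero. The factor ['X] in [q] rules out [d = 0],
    and [size q] distinct integers cannot all be roots of [q]. *)
Lemma generic_square (F : realFieldType) (r : {poly F}) (nu : F) :
  r != 0 -> nu != 0 -> exists2 d : F, d != 0 & r.[d ^+ 2 * nu] != 0.
Proof.
move=> r0 nu0; pose q := 'X * (r \Po (nu *: 'X^2)).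
have q0 : q != 0.
  by rewrite mulf_neq0 ?polyX_eq0 // comp_poly_eq0 // size_scale // size_polyXn.
have [k qk] : exists k : 'I_(size q), ~~ root q k%:R.
  apply/existsP; rewrite -negb_forall; apply/forallP => allq.
  have := @max_poly_roots _ q [seq (k : nat)%:R | k : 'I_(size q)] q0.
  rewrite size_map -cardE card_ord ltnn => absurd.
  suff: false by [].
  apply: absurd; first by apply/allP => _ /mapP[k _ ->].
  by rewrite map_inj_uniq ?enum_uniq // => k l /eqP; rewrite eqr_nat => /eqP/val_inj.
move: qk; rewrite /root hornerM hornerX horner_comp hornerZ hornerXn mulf_eq0 negb_or.
by case/andP=> k0 rk; exists k%:R => //; rewrite mulrC.
Qed.

(** * Construction of the matrix with a second multiple eigenvalue *)

Lemma twin_multiplicity (F : rcfType) (n : nat) (A : 'M[F]_n) (v : 'I_n)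
    (B1 B2 B3 : {set 'I_n}) (p q u w : 'I_n) (x y : 'rV[F]_n) :
  A^T = A ->
  (forall B, B \in [:: B1; B2; B3] ->
     forall i j, i \in B -> j \notin B -> j != v -> A i j = 0) ->
  [disjoint B1 & B2] -> [disjoint B1 & B3] -> [disjoint B2 & B3] ->
  p \in B1 -> q \in B1 -> A p q != 0 -> u \in B2 -> w \in B3 ->
  x *m A = 0 -> y *m A = 0 ->
  x 0 u = 1 -> x 0 w = 0 -> y 0 u = 0 -> y 0 w = 1 ->
  exists A' : 'M[F]_n, exists mu : F,
    [/\ A'^T = A', forall i j, i != j -> (A' i j != 0) = (A i j != 0),
        mu != 0, \rank (kermx A) = (\rank (kermx A')).+2
      & (2 <= \rank (kermx (A' - mu%:M)))%N].
Proof.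
move=> symA clB d12 d13 d23 pB qB Apq uB wB xA yA xu xw yu yw.
have symE i j : A i j = A j i by rewrite -{1}symA mxE.
have restr_sym : (restr B1 A)^T = restr B1 A.
  by apply/matrixP => i j; rewrite !mxE andbC symE.
have restr_n0 : restr B1 A != 0.
  by apply: contraNneq Apq => /matrixP/(_ p q); rewrite !mxE pB qB mulr1n => ->.
have [nu [z [nu0 z0 zE]]] := sym_nonzero_eigenvalue restr_sym restr_n0.
(* The roots of these monic polynomials are the values of [mu] that a bump at [s] might fail to
   reach. *)
pose r B s := char_poly (restr B A) * char_poly (row' s (col' s (restr B A))).
have r0 : r B2 u * r B3 w != 0.
  by rewrite !mulf_neq0 // monic_neq0 // char_poly_monic.
have [d dn0] := generic_square r0 nu0; set mu := d ^+ 2 * nu.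
have mu0 : mu != 0 by rewrite mulf_neq0 // expf_neq0.
rewrite hornerM mulf_eq0 negb_or => /andP[/diagonal_bump_eigenvalue[s [z2 [s0 z20 z2E]]]].
move=> /diagonal_bump_eigenvalue[t [z3 [t0 z30 z3E]]].
(* The congruence by [D] keeps symmetry, pattern and rank, and multiplies the block on [B1] by
   [d ^+ 2]. *)
pose c i := if i \in B1 then d else 1.
have c0 i : c i != 0 by rewrite /c; case: ifP; rewrite ?oner_eq0.
pose D := diag_mx (\row_i c i).
have Du : D \in unitmx.
  rewrite unitmxE det_diag unitfE; apply/prodf_neq0 => i _.
  by rewrite mxE.
pose A1 := D *m A *m D.
have A1E i j : A1 i j = c i * A i j * c j.
  by rewrite /A1 mul_mx_diag mul_diag_mx !mxE.
have symA1 : A1^T = A1.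
  by apply/matrixP => i j; rewrite mxE !A1E symE; ring.
have rkA1 : \rank (kermx A1) = \rank (kermx A).
  by rewrite !mxrank_ker /A1 mxrankMfree ?row_free_unit // eqmxMfull // row_full_unit.
pose A' := A1 + (s *: delta_mx u u + t *: delta_mx w w).
have A'E i j : A' i j = c i * A i j * c j + (s *+ ((i == u) && (j == u)) +
    t *+ ((i == w) && (j == w))).
  by rewrite mxE A1E !mxE !mulr_natr.
have offE i j : i != j -> (A' i j != 0) = (A i j != 0).
  move=> ij; rewrite A'E.
  have diag0 (a : F) k : a *+ ((i == k) && (j == k)) = 0.
    by case: (eqVneq i k) => [ik|//]; rewrite -ik eq_sym (negPf ij).
  by rewrite !diag0 !addr0 !mulf_eq0 !(negPf (c0 _)) orbF.
have symA' : A'^T = A'.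
  by apply/matrixP => i j; rewrite mxE !A'E symE ![(j == _) && _]andbC;
    ring.
have u1 : u \notin B1 by rewrite (disjointFl d12 uB).
have w1 : w \notin B1 by rewrite (disjointFl d13 wB).
have u3 : u \notin B3 by rewrite (disjointFr d23 uB).
have w2 : w \notin B2 by rewrite (disjointFl d23 wB).
have neqB i k (B : {set 'I_n}) : i \in B -> k \notin B -> i == k = false.
  by move=> iB; apply: contraNF => /eqP <-.
have c1 i : i \notin B1 -> c i = 1 by rewrite /c => /negPf ->.
have restrE B (C : 'M[F]_n) i j : restr B C i j = C i j *+ ((i \in B) && (j \in B)).
  by rewrite mxE.
have A'1 : restr B1 A' = d ^+ 2 *: restr B1 A.
  apply/matrixP => i j; rewrite [RHS]mxE !restrE A'E.
  case: (boolP ((i \in B1) && (j \in B1))) => [/andP[iB jB]|_]; last by rewrite !mulr0n ?mulr0.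
  by rewrite !(neqB i _ B1) // /c iB jB !mulr1n !mulr0n !addr0; ring.
have A'2 : restr B2 A' = restr B2 A + s *: delta_mx u u.
  apply/matrixP => i j; rewrite [RHS]mxE [X in _ + X]mxE [X in s * X]mxE !restrE A'E mulr_natr.
  case: (boolP (i \in B2)) => iB; last first.
    by rewrite !mulr0n add0r; case: eqP => // iu; rewrite iu uB in iB.
  case: (boolP (j \in B2)) => jB; last first.
    by rewrite !mulr0n add0r andbC; case: eqP => // ju; rewrite ju uB in jB.
  rewrite !c1 ?(disjointFl d12) // (neqB i w B2) // !mulr1n mul1r mulr1.
  by rewrite mulr0n addr0.
have A'3 : restr B3 A' = restr B3 A + t *: delta_mx w w.
  apply/matrixP => i j; rewrite [RHS]mxE [X in _ + X]mxE [X in t * X]mxE !restrE A'E mulr_natr.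
  case: (boolP (i \in B3)) => iB; last first.
    by rewrite !mulr0n add0r; case: eqP => // iw; rewrite iw wB in iB.
  case: (boolP (j \in B3)) => jB; last first.
    by rewrite !mulr0n add0r andbC; case: eqP => // jw; rewrite jw wB in jB.
  rewrite !c1 ?(disjointFl d13) // (neqB i u B3) // !mulr1n mul1r mulr1.
  by rewrite mulr0n add0r.
exists A', mu; split=> //.
  (* Kernel vectors of [A] pass to [A1] through [invmx D], which keeps the coordinates at [u] and
     [w] since these lie outside [B1]. *)
  have kerD (z' : 'rV_n) : z' *m A = 0 -> z' *m invmx D *m A1 = 0.
    by move=> z'A; rewrite /A1 !mulmxA mulmxKV // z'A mul0mx.
  have kerDE (z' : 'rV_n) i : i \notin B1 -> (z' *m invmx D) 0 i = z' 0 i.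
    move=> iB; have := congr1 (fun M : 'M_(1, n) => M 0 i) (mulmxKV Du z').
    by rewrite mul_mx_diag !mxE c1 // mulr1.
  rewrite -rkA1; apply: (nullity_two_bumps symA1 (kerD _ xA) (kerD _ yA)) => //;
    by rewrite kerDE.
apply: (three_branches (B := fun k => nth set0 [:: B1; B2; B3] k) (v := v)) => //.
- move=> k i j ik jk jv; have ij : i != j by apply: contraNneq jk => <-.
  have := offE i j ij; rewrite (clB _ _ _ _ ik jk jv) ?mem_nth //.
  by rewrite eqxx => /negbFE/eqP.
- by move=> [[|[|[|k]]] //= ?] [[|[|[|l]]] //= ?] //; rewrite disjoint_sym.
case=> [[|[|[|k]]] //= _]; rewrite ?A'1 ?A'2 ?A'3.
- by exists z; rewrite // -scalemxAr zE scalerA.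
- by exists z2.
- by exists z3.
Qed.

(** * Branches of a tree at a vertex *)

Section Branches.
Variables (T : finType) (e : rel T).
Hypothesis symE : symmetric e.

(** The vertex [v] stays in the type as an isolated point. *)
Definition vertex_deleted (v : T) : rel T := fun x y => [&& e x y, x != v & y != v].

Definition branch (v c : T) : {set T} := [set x | connect (vertex_deleted v) c x].

Lemma sub_vertex_deleted v : subrel (vertex_deleted v) e.
Proof. by move=> x y /and3P[]. Qed.

Lemma vertex_deleted_sym v : symmetric (vertex_deleted v).
Proof. by move=> x y; rewrite /vertex_deleted symE; congr (_ && _); rewrite andbC. Qed.

Lemma branch_refl v c : c \in branch v c.
Proof. by rewrite inE connect0. Qed.

Lemma center_notin_branch v c : c != v -> v \notin branch v c.
Proof.
move=> cv; rewrite inE; apply/negP => /connectP[p]; case/lastP: p => [_ vc|p x].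
  by rewrite vc eqxx in cv.
by rewrite rcons_path last_rcons => /andP[_ /and3P[_ _ xv]] vx; rewrite vx eqxx in xv.
Qed.

Lemma branch_step v c i j : c != v -> i \in branch v c -> e i j -> j != v ->
  j \in branch v c.
Proof.
move=> cv ib eij jv.
have iv : i != v by apply: contraNneq (center_notin_branch cv) => iv; rewrite -{1}iv.
move: ib; rewrite !inE => /connect_trans; apply; apply: connect1.
by rewrite /vertex_deleted eij iv jv.
Qed.

(** A simple path from [v] never returns to [v] after its first step. The subrelation [e'] allows a
    start inside a graph with another vertex deleted. *)
Lemma branch_cover (e' : rel T) v x : subrel e' e -> connect e' v x -> x != v ->
  exists2 c, e' v c & x \in branch v c.
Proof.
move=> sub /connectP[p0 + ->]; case/shortenP => -[|c q] /=; first by rewrite eqxx.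
case/andP=> evc pq; rewrite in_cons negb_or => /andP[/andP[vc vq] _] _ _.
exists c => //; rewrite inE; apply/connectP; exists q => //.
apply: (sub_in_path (P := predC1 v) _ _ pq) => [i j /= iv jv eij|].
  by apply/and3P; split=> //; apply: sub.
by apply/allP => i; rewrite in_cons => /orP[/eqP->|iq] /=;
  [rewrite eq_sym | apply: contraNneq vq => <-].
Qed.

Hypothesis irrE : irreflexive e.
Hypothesis acyclicE : forall c : seq T, ucycle e c -> (size c < 3)%N.

Lemma adj_neq x y : e x y -> x != y.
Proof. by apply: contraTneq => ->; rewrite irrE. Qed.

(** A common vertex gives a simple path from [c] to [c'] avoiding [v], which [v] closes to a cycle
    of length at least 3. *)
Lemma branch_disjoint v c c' : e v c -> e v c' -> c != c' ->
  [disjoint branch v c & branch v c'].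
Proof.
move=> ec ec' cc'; rewrite disjoint_subset; apply/subsetP => x; rewrite !inE => xc.
apply/negP; rewrite (sym_connect_sym (vertex_deleted_sym v)) => /(connect_trans xc).
move=> /connectP[p0 p0P]; move: (p0P); case/shortenP => p pP uniqp _ c'E.
have cv : c != v by rewrite eq_sym adj_neq.
have vp : v \notin c :: p.
  apply/negP => /(path_connect pP); apply/negP.
  by have := center_notin_branch cv; rewrite inE.
have : ucycle e [:: v, c & p].
  rewrite /ucycle cons_uniq vp uniqp /= ec rcons_path -c'E symE ec' !andbT.
  exact: sub_path (@sub_vertex_deleted v) _ _ pP.
move/acyclicE => /=; case: p c'E {pP uniqp vp} => //= c'c.
by rewrite c'c eqxx in cc'.
Qed.

(** The branch through [c] avoids [b] and hangs on [v], which it does not contain. This strict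
    inclusion drives the descent to a minimal branch. *)
Lemma branch_proper v b c : e v b -> e v c -> c != b -> branch v c \proper branch b v.
Proof.
move=> eb ec cb; have cv : c != v by rewrite eq_sym adj_neq.
have bc : b \notin branch v c.
  by rewrite (disjointFr (branch_disjoint eb ec _)) ?branch_refl // eq_sym.
apply/properP; split; last first.
  by exists v; [apply: branch_refl | apply: center_notin_branch].
apply/subsetP => x; rewrite !inE => /connectP[p pP ->].
have vb : v != b := adj_neq eb.
apply: (@connect_trans _ _ c).
  by apply: connect1; rewrite /vertex_deleted ec vb cb.
apply/connectP; exists p => //.
apply: (sub_in_path (P := mem (branch v c)) _ _ pP).
  move=> i j ic jc /sub_vertex_deleted eij.
  by apply/and3P; split=> //; apply: contraNneq bc => <-.
apply/allP => i ip; suff : i \in branch v c by [].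
by rewrite inE; apply: path_connect pP _ ip.
Qed.

Lemma branch_leaf v b : e v b -> (forall b', e b b' -> b' = v) ->
  forall x, x \in branch v b -> x = b.
Proof.
move=> eb leaf x; rewrite inE => /connectP[[//|y p] /= /andP[/and3P[eby _ yv] _]].
by rewrite (leaf y eby) eqxx in yv.
Qed.

Lemma center_of_star v : (forall x, connect e v x) ->
  (forall b b', e v b -> e b b' -> b' = v) ->
  forall i j, e i j = (i != j) && ((i == v) || (j == v)).
Proof.
move=> conn leaves; have adj x : x != v -> e v x.
  move=> xv; have [c ec xc] := branch_cover (fun _ _ h => h) (conn x) xv.
  by rewrite (branch_leaf ec (fun b' => leaves c b' ec) xc).
move=> i j; case: (eqVneq i j) => [->|ij]; first by rewrite irrE.
case: (eqVneq i v) => [iv|iv] /=; first by rewrite iv adj // -iv eq_sym.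
case: (eqVneq j v) => [jv|jv]; first by rewrite jv symE adj.
by apply/negP => /(leaves i j (adj i iv)) jv'; rewrite jv' eqxx in jv.
Qed.

End Branches.

(** * Independent coordinates on the kernel *)

(** Independence of two coordinate functionals on the kernel, given as the dual pair that the rank
    drop by 2 requires. *)
Definition indep (F : fieldType) (n : nat) (A : 'M[F]_n) (u w : 'I_n) : Prop :=
  exists x y : 'rV[F]_n,
    [/\ x *m A = 0, y *m A = 0, x 0 u = 1 /\ x 0 w = 0 & y 0 u = 0 /\ y 0 w = 1].

(** Equivalently, the kernel restricted to [S] has dimension at least 2. *)
Definition rich (F : fieldType) (n : nat) (A : 'M[F]_n) (S : {set 'I_n}) : Prop :=
  exists u w, [/\ u \in S, w \in S & indep A u w].

Section KernelCoordinates.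
Variables (F : fieldType) (n : nat) (A : 'M[F]_n).

Lemma indep_sym u w : indep A u w -> indep A w u.
Proof. by move=> [x [y [xA yA [? ?] [? ?]]]]; exists y, x. Qed.

Lemma indep_irr u : ~ indep A u u.
Proof. by move=> [x [y [_ _ [-> /eqP]]]]; rewrite oner_eq0. Qed.

Lemma not_indep u w (x y : 'rV[F]_n) : ~ indep A u w -> x *m A = 0 -> y *m A = 0 ->
  x 0 u * y 0 w = x 0 w * y 0 u.
Proof.
move=> dep xA yA; apply/eqP; rewrite -subr_eq0; apply/negP => /negP.
set dlt := _ - _ => dlt0; apply: dep.
(* Cramer's rule for the 2 by 2 matrix of values of [x], [y] at [u], [w]. *)
exists (dlt^-1 *: (y 0 w *: x - x 0 w *: y)), (dlt^-1 *: (x 0 u *: y - y 0 u *: x)).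
split; rewrite -?scalemxAl ?mulmxBl -?scalemxAl ?xA ?yA ?scaler0 ?subr0 ?scaler0 //.
  by rewrite !mxE; split; rewrite /dlt in dlt0 *; field.
by rewrite !mxE; split; rewrite /dlt in dlt0 *; field.
Qed.

(** On [S] all kernel vectors are proportional to one that is nonzero at [s]. If the kernel vanishes
    on [S], the default [v] serves. *)
Lemma dep_determined (S : {set 'I_n}) (v : 'I_n) :
  (forall u w, u \in S -> w \in S -> ~ indep A u w) ->
  exists s, forall x : 'rV[F]_n, x *m A = 0 -> x 0 s = 0 -> forall i, i \in S -> x 0 i = 0.
Proof.
move=> dep; have [[s [y [sS yA ys]]]|none] :=
    EM (exists s (y : 'rV[F]_n), [/\ s \in S, y *m A = 0 & y 0 s != 0]).
  exists s => x xA xs i iS; have := not_indep (dep i s iS sS) xA yA.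
  by rewrite xs mul0r => /eqP; rewrite mulf_eq0 (negPf ys) orbF => /eqP.
exists v => x xA _ i iS; apply/eqP; apply/negP => /negP xi.
by apply: none; exists i, x.
Qed.

End KernelCoordinates.

(** * Choice of the vertex and its three branches *)

Section GoodVertex.
Variables (F : fieldType) (n : nat) (e : rel 'I_n) (A : 'M[F]_n).
Hypothesis treeE : is_tree e.
Hypothesis patA : forall i j, i != j -> (A i j != 0) = e i j.

Let symE : symmetric e. Proof. by case: treeE. Qed.
Let irrE : irreflexive e. Proof. by case: treeE. Qed.
Let connE x y : connect e x y. Proof. by case: treeE. Qed.
Let acyE (c : seq 'I_n) : ucycle e c -> (size c < 3)%N.
Proof. by case: treeE => _ _ _ _; apply. Qed.

Let adjN x y : e x y -> x != y. Proof. exact: adj_neq. Qed.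

(** The branches start at [b], [c] and [c']; the edge from [b] to [b'] makes the submatrix on the
    first one nonzero. *)
Definition good_vertex v b u w : Prop :=
  exists b' c c', [/\ e v b, e b b' & b' != v] /\
    [/\ e v c, e v c', c != b, c' != b & c != c'] /\
    [/\ u \in branch e v c, w \in branch e v c' & indep A u w].

(* A kernel vector vanishing on the branch at c vanishes at v, by row c. *)
Lemma center_dep v c w : e v c -> ~ rich A (branch e v c) -> w \in branch e v c ->
  ~ indep A v w.
Proof.
move=> ec poor wc [x [y [xA yA [xv xw] [yv yw]]]].
have xc i : i \in branch e v c -> x 0 i = 0.
  move=> ic; have dep : ~ indep A i w by move=> iw; apply: poor; exists i, w.
  by have := not_indep dep xA yA; rewrite xw yw mulr1 mul0r.
have cv : c != v by rewrite eq_sym adjN.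
have : A v c != 0 by rewrite patA // adjN.
move/rowP: xA => /(_ c); rewrite !mxE (bigD1 v) //= big1 => [|i iv].
  by rewrite xv mul1r addr0 => ->; rewrite eqxx.
case: (eqVneq i c) => [->|ic]; first by rewrite xc ?mul0r ?branch_refl.
have [->|Aic] := eqVneq (A i c) 0; first by rewrite mulr0.
rewrite xc ?mul0r //; apply: branch_step cv (branch_refl _ _ _) _ iv.
by rewrite symE -patA.
Qed.

(** As [T] is not a star, some neighbour [b] of [v] is not a leaf. If the union [O] of the other
    branches is rich, [u] and [w] lie in different branches, none being rich alone. Otherwise three
    coordinates, at [v], in the branch of [b] and in [O], determine a kernel vector, against nullity
    at least 4. *)
Lemma good_vertex_of_poor v : (4 <= \rank (kermx A))%N -> ~ is_star e ->
  (forall c, e v c -> ~ rich A (branch e v c)) ->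
  exists b u w, good_vertex v b u w.
Proof.
move=> rk4 nstar poor.
have [b [b' [eb ebb' b'v]]] : exists b b', [/\ e v b, e b b' & b' != v].
  have [//|none] := EM (exists b b', [/\ e v b, e b b' & b' != v]).
  case: nstar; exists v; apply: center_of_star => // b b' eb ebb'.
  by apply/eqP/negP => /negP b'v; apply: none; exists b, b'.
exists b; pose O := [set x | [exists c, [&& e v c, c != b & x \in branch e v c]]].
have OP x : x \in O -> exists c, [/\ e v c, c != b & x \in branch e v c].
  by rewrite inE => /existsP[c /and3P[]]; exists c.
have [[u [w [/OP[c [ec cb uc]] /OP[c' [ec' c'b wc']] uw]]]|poorO] := EM (rich A O).
  exists u, w, b', c, c'; do !split => //; apply/eqP => cc'.
  by apply: (poor c ec); exists u, w; rewrite {2}cc'.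
have [s1 s1P] : exists s, forall x : 'rV_n, x *m A = 0 -> x 0 s = 0 ->
    forall i, i \in branch e v b -> x 0 i = 0.
  by apply: (dep_determined v) => u w ub wb uw; apply: (poor b eb); exists u, w.
have [s2 s2P] : exists s, forall x : 'rV_n, x *m A = 0 -> x 0 s = 0 ->
    forall i, i \in O -> x 0 i = 0.
  by apply: (dep_determined v) => u w uO wO uw; apply: poorO; exists u, w.
suff : (\rank (kermx A) <= #|[set v; s1; s2]|)%N.
  by have := cardsU1 s2 [set v; s1]; rewrite setUC => ->; rewrite cards2; lia.
apply: rank_le_coords => x /sub_kermxP xA x0; apply/rowP => i; rewrite mxE.
case: (eqVneq i v) => [->|iv]; first by rewrite x0 // !inE eqxx.
have [c ec ic] := branch_cover (fun _ _ h => h) (connE v i) iv.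
case: (eqVneq c b) => [cb|cb].
  by apply: (s1P x xA) => //; [rewrite x0 // !inE eqxx orbT | rewrite -cb].
apply: (s2P x xA) => //; first by rewrite x0 // !inE eqxx !orbT.
by rewrite inE; apply/existsP; exists c; rewrite ec cb.
Qed.

Lemma exists_good_vertex : (4 <= \rank (kermx A))%N -> ~ is_star e ->
  exists v b u w, good_vertex v b u w.
Proof.
move=> rk4 nstar.
have descent k : forall b v, (#|branch e b v| < k)%N -> e v b ->
    rich A (branch e b v) -> exists v b u w, good_vertex v b u w.
  elim: k => // k IH b v; rewrite ltnS => lek eb [u [w [ub wb uw]]].
  have [[c [ec cb richc]]|poor] :=
      EM (exists c, [/\ e v c, c != b & rich A (branch e v c)]).
    apply: (IH v c) => //; last by rewrite symE.
    by apply: leq_trans lek; apply/proper_card/branch_proper.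
  have nbr x : x \in branch e b v -> x != v ->
      exists c, [/\ e v c, c != b & x \in branch e v c].
    rewrite inE => /(branch_cover (@sub_vertex_deleted _ e b)) H /H[c].
    by move=> /and3P[ec _ cb] xc; exists c.
  (* In a minimal rich branch, [v] is dependent with every vertex, so [u] and [w] differ from [v]
     and lie in two distinct poor branches. *)
  have not_center x : x \in branch e b v -> ~ indep A v x.
    move=> xb vx; case: (eqVneq x v) => [xv|xv].
      by rewrite xv in vx; apply: indep_irr vx.
    have [c [ec cb xc]] := nbr x xb xv.
    by apply: (center_dep ec _ xc vx) => richc; apply: poor; exists c.
  have uv : u != v by apply/eqP => uv; apply: (not_center w) => //; rewrite -uv.
  have wv : w != v.
    by apply/eqP => wv; apply: (not_center u) => //; rewrite -wv; apply: indep_sym.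
  have [[b' [ebb' b'v]]|leaf] := EM (exists b', e b b' /\ b' != v).
    have [c [ec cb uc]] := nbr u ub uv; have [c' [ec' c'b wc']] := nbr w wb wv.
    exists v, b, u, w, b', c, c'; do !split => //; apply/eqP => cc'.
    by apply: poor; exists c; split=> //; exists u, w; rewrite {2}cc'.
  (* Here [b] is a leaf, so its branch at [v] is a single vertex and every branch at [v] is poor. *)
  exists v; apply: good_vertex_of_poor => // c ec richc.
  case: (eqVneq c b) => [cb|cb]; last by apply: poor; exists c.
  rewrite cb in richc; case: richc => [u' [w' [u'b w'b u'w']]].
  have leafE b' : e b b' -> b' = v.
    by move=> ebb'; apply/eqP/negP => /negP b'v; apply: leaf; exists b'.
  move: u'w'; rewrite (branch_leaf eb leafE u'b) (branch_leaf eb leafE w'b).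
  exact: indep_irr.
have [[b [v [eb richb]]]|poor] := EM (exists b v, e v b /\ rich A (branch e b v)).
  exact: (descent _ b v (ltnSn _) eb richb).
have n0 : (0 < n)%N by case: treeE.
exists (Ordinal n0); apply: good_vertex_of_poor => // c ec richc.
by apply: poor; exists (Ordinal n0), c; rewrite symE.
Qed.

End GoodVertex.

(** * Stars are 3-NIM *)

(** Nullity 2 gives a nonzero kernel vector vanishing at [c], hence a leaf [l] with diagonal entry
    [mu]; its equation makes every kernel vector vanish at [c]. Kernel vectors then live on [L], and
    the equation at [c] recovers the coordinate at [l] from the others. *)
Lemma star_multiplicity (F : fieldType) (n : nat) (A : 'M[F]_n) (c : 'I_n) (mu : F) :
  (forall i j, i != j -> (A i j != 0) = (i == c) || (j == c)) ->
  (2 <= \rank (kermx (A - mu%:M)))%N ->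
  (\rank (kermx (A - mu%:M)) < #|[set i | (i != c) && (A i i == mu)]|)%N.
Proof.
move=> patA; set B := A - mu%:M => rk2; set L := [set i | _].
have Boff i j : i != j -> B i j = A i j by move=> ij; rewrite !mxE (negPf ij) subr0.
have Bdiag i : B i i = A i i - mu by rewrite !mxE eqxx.
have leaf_eq (x : 'rV_n) i : x *m B = 0 -> i != c ->
    x 0 i * (A i i - mu) + x 0 c * A c i = 0.
  move=> /rowP/(_ i) + ic; rewrite !mxE (bigD1 i) //= (bigD1 c) ?[c == i]eq_sym //=.
  rewrite big1 => [|j /andP[ji jc]]; first by rewrite addr0 Bdiag Boff // eq_sym.
  rewrite Boff //; apply/eqP; rewrite mulf_eq0 -[A j i == 0]negbK patA //.
  by rewrite (negPf jc) (negPf ic) orbT.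
have [x [xB xc xn0]] : exists x : 'rV[F]_n, [/\ x *m B = 0, x 0 c = 0 & x != 0].
  have [//|none] := EM (exists x : 'rV[F]_n, [/\ x *m B = 0, x 0 c = 0 & x != 0]).
  suff : (\rank (kermx B) <= #|[set c]|)%N by rewrite cards1 leqNgt rk2.
  apply: rank_le_coords => x /sub_kermxP xB xc; apply/eqP/negP => /negP xn0.
  by apply: none; exists x; rewrite xc ?inE.
have [l xl] : exists l, x 0 l != 0.
  apply/existsP; rewrite -negb_forall; apply: contra xn0 => /forallP x0.
  by apply/eqP/rowP => i; rewrite mxE (eqP (x0 i)).
have lc : l != c by apply: contraNneq xl => ->; rewrite xc.
have All : A l l = mu.
  have := leaf_eq x l xB lc; rewrite xc mul0r addr0 => /eqP.
  by rewrite mulf_eq0 (negPf xl) subr_eq0 => /eqP.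
have kerc (y : 'rV_n) : y *m B = 0 -> y 0 c = 0.
  move=> yB; have := leaf_eq y l yB lc; rewrite All subrr mulr0 add0r => /eqP.
  by rewrite mulf_eq0 -[A c l == 0]negbK patA 1?eq_sym // eqxx orbF => /eqP.
have lL : l \in L by rewrite inE lc All eqxx.
rewrite [X in (_ < X)%N](cardsD1 l) lL ltnS.
apply: rank_le_coords => y /sub_kermxP yB y0.
have yc := kerc y yB.
have ynl i : i != l -> y 0 i = 0.
  move=> il; case: (eqVneq i c) => [->//|ic].
  have [Aii|Aii] := eqVneq (A i i) mu; first by apply: y0; rewrite !inE il ic Aii eqxx.
  have := leaf_eq y i yB ic; rewrite yc mul0r addr0 => /eqP.
  by rewrite mulf_eq0 subr_eq0 (negPf Aii) orbF => /eqP.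
apply/rowP => i; rewrite mxE; case: (eqVneq i l) => [->|]; last exact: ynl.
move/rowP: yB => /(_ c); rewrite !mxE (bigD1 l) //= big1 => [|j jl]; last first.
  by rewrite ynl ?mul0r.
rewrite addr0 Boff // => /eqP; rewrite mulf_eq0 -[A l c == 0]negbK patA //.
by rewrite eqxx orbT orbF => /eqP.
Qed.

(** The adjacency matrix is a sum of two matrices of rank at most 1; this yields
    [n - 2 <= M(S_n)]. *)
Lemma star_adjacency_nullity (F : fieldType) (n : nat) (c : 'I_n) :
  (n - 2 <= \rank (kermx (\matrix_(i, j) ((i != j) && ((i == c) || (j == c)))%:R
      : 'M[F]_n)))%N.
Proof.
set A := \matrix_(i, j) _; rewrite mxrank_ker leq_sub2l //.
have -> : A = delta_mx c (0 : 'I_1) *m (\row_j (j != c)%:R) +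
              (\col_i (i != c)%:R) *m delta_mx (0 : 'I_1) c.
  apply/matrixP => i j; rewrite !mxE !big_ord1 !mxE !eqxx /= andbT.
  case: (eqVneq i c) => [->|ic]; case: (eqVneq j c) => [jc|jc] /=;
    by rewrite ?jc ?ic ?andbF ?mulr0 ?mul0r ?mulr1 ?addr0 ?add0r.
apply: leq_trans (mxrank_add _ _) _; rewrite -[2%N]/(1 + 1)%N leq_add //.
  by apply: leq_trans (mxrankM_maxl _ _) (rank_leq_col _).
by apply: leq_trans (mxrankM_maxl _ _) (rank_leq_col _).
Qed.

Lemma star_NIM3 (R : realType) (n : nat) (e : rel 'I_n) (m : nat) :
  is_M R e m -> (4 <= m)%N -> is_star e -> NIM3 R e m.
Proof.
move=> [_ maxM] m4 [c starE]; split=> [|A lam [symA patA] mult_lam m2 mu mulam mu_pos].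
  exact: leq_trans m4.
have patS i j : i != j -> (A i j != 0) = (i == c) || (j == c).
  by move=> ij; rewrite patA // starE ij.
have nm : (n - 2 <= m)%N.
  pose S : 'M[R]_n := \matrix_(i, j) ((i != j) && ((i == c) || (j == c)))%:R.
  have symS : S^T = S by apply/matrixP => i j; rewrite !mxE eq_sym orbC.
  have := maxM S 0; rewrite /mult mup_char_poly_sym // raddf0 subr0 => H.
  apply: leq_trans (star_adjacency_nullity R c) (H _); split=> // i j ij.
  by rewrite mxE starE ij; case: (_ || _); rewrite ?oner_eq0 ?eqxx.
apply/eqP; rewrite eqn_leq mu_pos andbT leqNgt; apply/negP => mu2.
move: mult_lam mu2 m2; rewrite /mult !mup_char_poly_sym // => lamE mu2; rewrite -{1}lamE.
move=> /(star_multiplicity patS); have := star_multiplicity patS mu2.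
set Lmu := [set i | _]; set Llam := [set i | _] => ltmu ltlam.
have disj : Lmu :&: Llam = set0.
  apply/setP => i; rewrite !inE; case: eqP => //= _; apply/negP => /andP[/eqP ->].
  by rewrite (negPf mulam).
have sub : Lmu :|: Llam \subset [set~ c].
  by apply/subsetP => i; rewrite !inE => /orP[] /andP[].
(* The disjoint leaf sets have at least 3 and [m - 1] elements, in total [m + 2 >= n], but there are
   only [n - 1] leaves. *)
have := subset_leq_card sub; rewrite cardsU disj cards0 cardsC1 card_ord.
rewrite lamE in ltlam.
have := ltn_ord c; move: #|Lmu| #|Llam| ltmu ltlam => a b.
move=> mua lamb cn ab; have a3 : (2 < a)%N := leq_ltn_trans mu2 mua.
have n0 : (0 < n)%N := leq_ltn_trans (leq0n c) cn.
clear -m4 nm a3 lamb ab n0; lia.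
Qed.

(** * Non-stars are not 3-NIM, and the equivalence *)

Lemma NIM3_star (R : realType) (n : nat) (e : rel 'I_n) (m : nat) :
  is_tree e -> is_M R e m -> (4 <= m)%N -> NIM3 R e m -> is_star e.
Proof.
move=> treeE [[A0 [lam [[symA0 patA0] multA0]]] _] m4 [_ nim].
have [//|nstar] := EM (is_star e).
(* The shift keeps the pattern and turns the extremal eigenvalue into 0, so the nullity is [m]. *)
pose A := A0 - lam%:M.
have symA : A^T = A by rewrite /A linearB /= symA0 tr_scalar_mx.
have patA i j : i != j -> (A i j != 0) = e i j.
  by move=> ij; rewrite -patA0 // !mxE (negPf ij) subr0.
have rkA : \rank (kermx A) = m by rewrite -multA0 /mult mup_char_poly_sym.
have [|v [b [u [w]]]] := exists_good_vertex treeE patA _ nstar.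
  by rewrite rkA.
move=> [b' [c [c' [[evb ebb' b'v] [[evc evc' cb c'b cc'] [uc wc']]]]]].
move=> [x [y [xA yA [xu xw] [yu yw]]]].
have [_ symE irrE _ acyE] := treeE.
have nbr d : e v d -> d != v by move=> evd; rewrite eq_sym (adj_neq irrE).
have disj := branch_disjoint symE irrE acyE.
have Abb' : A b b' != 0 by rewrite patA // (adj_neq irrE).
have [||||||A' [mu [symA' patA' mu0 rkA' rkmu]]] :=
    twin_multiplicity (v := v) (B1 := branch e v b) (B2 := branch e v c)
      (B3 := branch e v c') symA _ _ _ _ _ _ Abb' uc wc' xA yA xu xw yu yw.
- move=> B BE i j iB jB jv; apply/eqP; rewrite -[_ == 0]negbK; apply/negP => Aij.
  have ij : i != j by apply: contraNneq jB => <-.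
  rewrite patA // in Aij; case/negP: jB; move: iB.
  move: BE; rewrite !inE => /or3P[] /eqP -> iB;
    by apply: branch_step iB Aij jv => //; apply: nbr.
- by apply: disj; rewrite // eq_sym.
- by apply: disj; rewrite // eq_sym.
- exact: disj.
- exact: branch_refl.
- by apply: branch_step (branch_refl _ _ _) ebb' b'v => //; apply: nbr.
have ST' : in_ST e A' by split=> // i j ij; rewrite patA' ?patA.
have mult0 : mult A' 0 = (m - 2)%N.
  by rewrite /mult mup_char_poly_sym // raddf0 subr0 -rkA rkA' subn2.
have := nim A' 0 ST' mult0 _ mu mu0; rewrite /mult mup_char_poly_sym // => H.
have : \rank (kermx (A' - mu%:M)) = 1%N by apply: H; [lia | apply: ltnW].
by move=> rk1; rewrite rk1 in rkmu.
Qed.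

Theorem theorem2p4 (R : realType) (n : nat) (e : rel 'I_n) (m : nat) :
  is_tree e -> is_M R e m -> (4 <= m)%N ->
  (NIM3 R e m <-> is_star e).
Proof.
by move=> treeE isM m4; split; [apply: NIM3_star | apply: star_NIM3].
Qed.
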